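(* Let $d\ge 1$, let $\Gamma=G+H$ be a joined graph that is balanced in $\mathbb{R}^d$ (i.e. $|V_G|,|V_H|\geq d+1$), and let $(\Gamma,p)$ be a generic $d$-dimensional framework. Then the quadric rigidity matrix of $(\Gamma,p)$ has rank $\binom{d+2}{2}$ if and only if $(\Gamma,p)$ is infinitesimally rigid.
   Context: All graphs are finite, undirected and simple. The graph join $G+H$ has vertex set $V_G\sqcup V_H$ and edge set $E_G\cup E_H\cup\{v_gv_h : v_g\in V_G, v_h\in V_H\}$; such a graph is called a joined graph and the edges in $E_G\cup E_H$ are its extraneous edges. A $d$-dimensional framework $(\Gamma,p)$ is a graph $\Gamma=(V,E)$ with a configuration $p:V\to\mathbb{R}^d$, $v_i\mapsto p_i$, where not all vertices lie on a hyperplane. It is generic if the coordinates of its vertices are algebraically independent over $\mathbb{Z}$. An infinitesimal motion of $(\Gamma,p)$ is an assignment $p'=(p_i')$ of vectors of $\mathbb{R}^d$ to the vertices such that $(p_i-p_j)\cdot(p_i'-p_j')=0$ for every edge $v_iv_j$. An infinitesimal motion which is not an (infinitesimal) Euclidean motion is an infinitesimal flex; $(\Gamma,p)$ is infinitesimally rigid if it has no infinitesimal flex (equivalently, the space of infinitesimal motions has dimension $\binom{d+1}{2}$). The constraint mapping $m:\mathbb{R}^d\times\mathbb{R}^d\to\mathbb{R}^{\binom{d+2}{2}}$ sends $(x,y)$ with $x=(x_1,\dots,x_d)$, $y=(y_1,\dots,y_d)$ to the vector with entries $x_iy_i$ ($1\le i\le d$), $x_jy_k+x_ky_j$ ($1\le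 j<k\le d$), $x_l+y_l$ ($1\le l\le d$), and $1$. The quadric rigidity matrix of the framework $(G+H,p)$ with vertex set $V$ and extraneous edge set $E'$ is the $(|V|+|E'|)\times\binom{d+2}{2}$ matrix whose rows are $m(p_i,p_i)$ for all $v_i\in V$ and $m(p_i,p_j)$ for all $v_iv_j\in E'$. *)

(* Defs.v *)
From HB Require Import structures.
From mathcomp Require Import all_boot all_order all_algebra.
From mathcomp Require Import reals zify.
(* The notations of mpoly are incompatible with those of mathcomp-analysis. *)
From mathcomp Require Import -(notations) mpoly.

Set Implicit Arguments.
Unset Strict Implicit.
Unset Printing Implicit Defensive.

Import Order.TTheory GRing.Theory Num.Theory.
Local Open Scope ring_scope.

Record sgraph := SGraph {
  vert :> finType;
  adj : rel vert;
  adj_sym : ssrbool.symmetric adj;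
  adj_irr : irreflexive adj }.

Section Join.
Variables G H : sgraph.

Definition extraneous (u v : G + H) : bool :=
  match u, v with
  | inl a, inl b => adj a b
  | inr a, inr b => adj a b
  | _, _ => false
  end.

Definition crossing (u v : G + H) : bool :=
  match u, v with
  | inl _, inr _ | inr _, inl _ => true
  | _, _ => false
  end.

Definition join_adj : rel (G + H)%type :=
  fun u v => extraneous u v || crossing u v.

Lemma join_adj_sym : ssrbool.symmetric join_adj.
Proof. by move=> [a|a] [b|b]; rewrite /join_adj //= adj_sym. Qed.

Lemma join_adj_irr : irreflexive join_adj.
Proof. by move=> [a|a]; rewrite /join_adj /= adj_irr. Qed.

Definition join : sgraph := SGraph join_adj_sym join_adj_irr.

(* Each unordered extraneous edge is listed once, oriented by the enumeration
   of the vertices; [constraintC] makes the orientation irrelevant. *)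
Definition extraneous_edges : {set join * join} :=
  [set e : join * join |
    extraneous e.1 e.2 && (enum_rank e.1 < enum_rank e.2)%N].

Definition balanced (d : nat) : Prop := (d.+1 <= #|G|)%N /\ (d.+1 <= #|H|)%N.

End Join.

Definition dot (R : realType) (d : nat) (x y : 'rV[R]_d) : R :=
  \sum_(k < d) x 0 k * y 0 k.

Definition on_hyperplane (R : realType) (d : nat) (V : finType)
    (p : V -> 'rV[R]_d) : Prop :=
  exists (a : 'rV[R]_d) (b : R), a != 0 /\ forall i, dot a (p i) = b.

Record framework (R : realType) (d : nat) (Gamma : sgraph) := Framework {
  config :> Gamma -> 'rV[R]_d;
  config_spans : ~ on_hyperplane config }.

Section Frameworks.
Variables (R : realType) (d : nat) (Gamma : sgraph) (p : framework R d Gamma).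

Definition coords (k : 'I_#|{: Gamma * 'I_d}|) : R :=
  p (enum_val k).1 0 (enum_val k).2.

Definition generic : Prop :=
  forall P : mpoly #|{: Gamma * 'I_d}| int,
    mmap intr coords P = 0 -> P = 0.

Definition infinitesimal_motion (p' : Gamma -> 'rV[R]_d) : Prop :=
  forall i j : Gamma, adj i j -> dot (p i - p j) (p' i - p' j) = 0.

(* The Lie algebra of the Euclidean group consists of the affine vector fields
   x |-> x *m A + t with A skew-symmetric. *)
Definition infinitesimal_Euclidean_motion (p' : Gamma -> 'rV[R]_d) : Prop :=
  exists (A : 'M[R]_d) (t : 'rV[R]_d),
    A^T = - A /\ forall i, p' i = p i *m A + t.

Definition infinitesimal_flex (p' : Gamma -> 'rV[R]_d) : Prop :=
  infinitesimal_motion p' /\ ~ infinitesimal_Euclidean_motion p'.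

Definition infinitesimally_rigid : Prop :=
  ~ exists p' : Gamma -> 'rV[R]_d, infinitesimal_flex p'.

End Frameworks.

Definition ltpairs (d : nat) : {set 'I_d * 'I_d} :=
  [set jk : 'I_d * 'I_d | (jk.1 < jk.2)%N].

(* The four blocks of coordinates of the constraint mapping; see [qdimE]. *)
Definition qdim (d : nat) : nat := (d + (#|ltpairs d| + (d + 1)))%N.

Lemma card_ltpairs (d : nat) : #|ltpairs d| = 'C(d, 2).
Proof.
rewrite -bin2_sum big_mkord -sum1_card.
under eq_bigl do rewrite inE.
rewrite -(pair_big_dep xpredT (fun j k : 'I_d => (j < k)%N) (fun _ _ => 1%N)).
rewrite /= (exchange_big_dep xpredT) //=; apply: eq_bigr => k _.
by rewrite -(big_ord_widen d (fun _ => 1%N) (ltnW (ltn_ord k))) sum1_card card_ord.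
Qed.

Lemma qdimE (d : nat) : qdim d = 'C(d + 2, 2).
Proof. by rewrite /qdim card_ltpairs addn2 !binS !bin0 !bin1; lia. Qed.

Section Constraint.
Variables (R : realType) (d : nat).

Definition constraint (x y : 'rV[R]_d) : 'rV[R]_(qdim d) :=
  row_mx (\row_(i < d) (x 0 i * y 0 i))
 (row_mx (\row_(k < #|ltpairs d|)
            let jk := enum_val k in
            x 0 jk.1 * y 0 jk.2 + x 0 jk.2 * y 0 jk.1)
 (row_mx (\row_(l < d) (x 0 l + y 0 l))
         (const_mx 1))).

Lemma constraintC (x y : 'rV[R]_d) : constraint x y = constraint y x.
Proof.
congr (row_mx _ (row_mx _ (row_mx _ _))); apply/rowP=> k; rewrite !mxE.
- exact: mulrC.
- by rewrite /= addrC; congr (_ + _); exact: mulrC.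
- exact: addrC.
Qed.

Definition quadric_rigidity_mx (G H : sgraph) (p : framework R d (join G H)) :
    'M[R]_(#|join G H| + #|extraneous_edges G H|, qdim d) :=
  col_mx
    (\matrix_(k < #|join G H|) constraint (p (enum_val k)) (p (enum_val k)))
    (\matrix_(k < #|extraneous_edges G H|)
       let e := enum_val k in constraint (p e.1) (p e.2)).

End Constraint.

(* Main.v *)
Require Import Defs.
From mathcomp Require Import all_boot all_order all_algebra.
From mathcomp Require Import reals.
From mathcomp Require Import ring.
From mathcomp Require Import -(notations) mpoly.

Set Implicit Arguments.
Unset Strict Implicit.
Unset Printing Implicit Defensive.

Import Order.TTheory GRing.Theory Num.Theory.
Local Open Scope ring_scope.

(** The theorem is linear algebra in homogeneous coordinates.  Write
    x^ = (1, x) for a point x, and attach to a velocity v at x the vector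
    v^ = (- x . v, v), the unique lift of v with x^ . v^ = 0.  Then
    - (x - y) . (v - w) = v^ . y^ + x^ . w^ ([edge_homv]), so an edge
    constraint is bilinear, and a motion is Euclidean exactly when v^ = x^ N at
    every vertex for one skew-symmetric N ([infinitesimal_Euclidean_skew]).

    On the side of the rigidity matrix, its kernel is the space of symmetric
    matrices Q, seen as quadrics x^ Q (x^)^T = 0, that pass through every vertex
    and for which the two ends of every extraneous edge are conjugate
    ([quadric_rigidity_mx_ker]).  The rank is full iff there is no such Q <> 0,
    so flexes have to be matched with quadrics.

    From flexes to quadrics: by genericity, d + 1 vertices on either side are
    affinely independent.  The crossing edges then force the lifted velocities
    to be linear in the lifted points, v^ = x^ N on the side of G and
    v^ = - x^ N^T on the side of H ([joined_motion_matrix]).  Put Q = N + N^T.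
    The relation x^ . v^ = 0 says that Q passes through the vertices, and the
    extraneous edges say that their ends are conjugate.  If Q = 0, then N is
    skew-symmetric and equals - N^T, hence the motion is Euclidean.

    From quadrics to flexes: v^ = x^ Q on the side of G and v^ = - x^ Q on the
    side of H is a motion.  If Q <> 0, it is not Euclidean, because on the side
    of G alone this would force Q to be skew-symmetric as well as symmetric
    ([quadric_joined_flex]). *)

(** * Linear algebra *)

Section MatrixAlgebra.
Variable F : fieldType.

Lemma mulmx_tr_matrix_row m n (w : 'rV[F]_n) (v : 'I_m -> 'rV[F]_n) :
  w *m (\matrix_i v i)^T = \row_i (w *m (v i)^T) 0 0.
Proof.
by apply/rowP=> j; rewrite !mxE; apply: eq_bigr => k _; rewrite !mxE.
Qed.

Lemma matrix_row_mul m n k (v : 'I_m -> 'rV[F]_n) (A : 'M[F]_(n, k)) :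
  (\matrix_i v i) *m A = \matrix_i (v i *m A).
Proof. by apply/row_matrixP=> i; rewrite row_mul !rowK. Qed.

(** This is what makes complete bipartite frameworks tractable: for fixed [i],
    the relations with a basis among the [v j] are a linear system that
    determines [u' i] from [u i], linearly.  Exchanging the roles, [v'] is
    linear in [v], and the relations force the second matrix to be minus the
    transpose of the first. *)
Lemma linear_from_crossing n (I J : Type)
    (u u' : I -> 'rV[F]_n) (v v' : J -> 'rV[F]_n) (f : 'I_n -> I) (g : 'I_n -> J) :
  \matrix_i u (f i) \in unitmx -> \matrix_i v (g i) \in unitmx ->
  (forall i j, u' i *m (v j)^T + u i *m (v' j)^T = 0) ->
  exists N, (forall i, u' i = u i *m N) /\ (forall j, v' j = - (v j *m N^T)).
Proof.
set U := (X in X \in _) => Uunit; set V := (X in X \in _) => Vunit cross.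
pose V' := \matrix_i v' (g i).
have Vtu : V^T \in unitmx by rewrite unitmx_tr.
pose N := - (V'^T *m invmx V^T).
have uN i : u' i = u i *m N.
  apply: (can_inj (mulmxK Vtu)); rewrite mulmxN mulNmx -!mulmxA mulVmx // mulmx1.
  apply/eqP; rewrite -addr_eq0; apply/eqP.
  rewrite !mulmx_tr_matrix_row; apply/rowP=> j.
  by have /matrixP/(_ 0 0) := cross i (g j); rewrite !mxE.
exists N; split=> // j.
apply: trmx_inj; rewrite linearN /= trmx_mul trmxK.
apply/eqP; rewrite -addr_eq0; apply/eqP.
apply: (can_inj (mulKmx Uunit)); rewrite mulmx0 matrix_row_mul.
apply/matrixP=> i k; rewrite mxE [RHS]mxE addrC.
have /matrixP/(_ 0 k) := cross (f i) j; rewrite uN -mulmxA -mulmxDr.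
by rewrite [X in _ = X -> _]mxE.
Qed.

Lemma row_fullP_ker m n (A : 'M[F]_(m, n)) :
  row_full A <-> forall c : 'cV_n, A *m c = 0 -> c = 0.
Proof.
split=> [Afull c Ac0|ker0].
  by apply: (row_full_inj Afull); rewrite mulmx0.
rewrite -cokermx_eq0; apply/eqP/trmx_inj/row_matrixP=> j.
by rewrite -tr_col trmx0 row0 [col j _]ker0 ?trmx0 // colE mulmxA mulmx_coker mul0mx.
Qed.

End MatrixAlgebra.

Lemma sum_ltpairs (F : fieldType) d (f : 'I_d -> 'I_d -> F) :
  \sum_(e in ltpairs d) f e.1 e.2 = \sum_(i < d) \sum_(j < d | (i < j)%N) f i j.
Proof. by rewrite pair_big_dep; apply: eq_bigl => e; rewrite inE. Qed.

Lemma sum_sym_pairs (F : fieldType) d (f : 'I_d -> 'I_d -> F) :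
  \sum_i \sum_j f i j =
  \sum_i f i i + \sum_(e in ltpairs d) (f e.1 e.2 + f e.2 e.1).
Proof.
rewrite big_split /= sum_ltpairs (sum_ltpairs (fun j k => f k j)).
rewrite [X in _ = _ + (_ + X)](exchange_big_dep xpredT) //= -!big_split /=.
apply: eq_bigr => i _; rewrite (bigD1 i) //=; congr (_ + _).
rewrite (bigID (fun j : 'I_d => (i < j)%N)) /=; congr (_ + _);
  by apply: eq_bigl => j; rewrite -val_eqE /=; case: ltngtP.
Qed.

(** * Homogeneous coordinates *)

Section Homogeneous.
Variables (R : realType) (d : nat).
Implicit Types (x y v w t : 'rV[R]_d) (Q N : 'M[R]_(1 + d)).

(** The constant coordinate stands first, so that the lifts of the origin and
    of the standard basis form a triangular matrix. *)
Definition hom x : 'rV[R]_(1 + d) := row_mx 1%:M x.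
(** Derivative of the lift [(- |x|^2 / 2, x)] of [x] to the paraboloid. *)
Definition homv x v : 'rV[R]_(1 + d) := row_mx (- dot x v)%:M v.

Lemma dotE x y : x *m y^T = (dot x y)%:M.
Proof.
rewrite [LHS]mx11_scalar !mxE; congr (_%:M).
by apply: eq_bigr => k _; rewrite mxE.
Qed.

Lemma mul_hom_homv x y w : hom x *m (homv y w)^T = (dot x w - dot y w)%:M.
Proof.
rewrite tr_row_mx mul_row_col mul1mx tr_scalar_mx dotE.
by rewrite -raddfD /= addrC.
Qed.

Lemma mul_homv_hom x v y : homv x v *m (hom y)^T = (dot y v - dot x v)%:M.
Proof. by rewrite -[LHS]trmxK trmx_mul trmxK mul_hom_homv tr_scalar_mx. Qed.

Lemma edge_homv x y v w :
  homv x v *m (hom y)^T + hom x *m (homv y w)^T = (- dot (x - y) (v - w))%:M.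
Proof.
rewrite mul_homv_hom mul_hom_homv -raddfD /=; congr (_%:M).
rewrite /dot -!sumrB -big_split -sumrN /=; apply: eq_bigr => k _.
rewrite !mxE; ring.
Qed.

(** The orthogonality [x^ . v^ = 0] determines the extra coordinate of a lifted
    velocity. *)
Lemma homv_rsubmx x (u : 'rV_(1 + d)) :
  hom x *m u^T = 0 -> homv x (rsubmx u) = u.
Proof.
rewrite -{1 3}[u]hsubmxK tr_row_mx mul_row_col mul1mx dotE => /eqP.
rewrite addr_eq0 => /eqP e; congr row_mx.
by rewrite raddfN /= -e [lsubmx u]mx11_scalar tr_scalar_mx.
Qed.

Lemma eq_oppmx0 m n (A : 'M[R]_(m, n)) : A = - A -> A = 0.
Proof.
move=> AN; apply/matrixP=> i j; have /matrixP/(_ i j)/eqP := AN.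
by rewrite !mxE -addr_eq0 -mulr2n mulrn_eq0 => /eqP.
Qed.

Lemma skew_form0 n (A : 'M[R]_n) (u : 'rV_n) : A^T = - A -> u *m A *m u^T = 0.
Proof.
move=> Askew; apply: eq_oppmx0; set c := u *m A *m u^T.
have {1}-> : c = c^T by rewrite [c]mx11_scalar tr_scalar_mx.
by rewrite /c !trmx_mul trmxK Askew mulNmx mulmxN mulmxA.
Qed.

Lemma quadric_eq0 (u : 'I_(1 + d) -> 'rV[R]_(1 + d)) Q :
  \matrix_i u i \in unitmx -> (forall i j, u i *m Q *m (u j)^T = 0) -> Q = 0.
Proof.
set U := \matrix_i u i => Uunit Q0.
have Utu : U^T \in unitmx by rewrite unitmx_tr.
apply: (can_inj (mulmxK Utu)); apply: (can_inj (mulKmx Uunit)).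
rewrite mul0mx mulmx0 mulmxA !matrix_row_mul.
apply/matrixP=> i j; rewrite mxE mulmx_tr_matrix_row !mxE.
have /matrixP/(_ 0 0) := Q0 i j.
by rewrite !mxE.
Qed.

(** Infinitesimal Euclidean motions [x *m A + t] are the skew-symmetric
    matrices with blocks [0], [t], [- t^T], [A]: the [x *m A] part contributes
    nothing to [dot x (x *m A + t)] as [A] is skew-symmetric. *)
Lemma infinitesimal_Euclidean_skew (Gamma : sgraph) (p : framework R d Gamma)
    (p' : Gamma -> 'rV[R]_d) :
  infinitesimal_Euclidean_motion p p' <->
  exists N, N^T = - N /\ forall i, homv (p i) (p' i) = hom (p i) *m N.
Proof.
split=> [[A [t [Askew p'E]]]|[N [Nskew p'E]]].
  exists (block_mx 0 t (- t^T) A); split.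
    by rewrite tr_block_mx opp_block_mx trmx0 !raddfN /= trmxK Askew opprK oppr0.
  move=> i; rewrite mul_row_block !mul1mx add0r mulmxN dotE p'E addrC.
  congr row_mx; rewrite -dotE raddfN /= -dotE linearD /= mulmxDr.
  by rewrite trmx_mul Askew mulNmx mulmxN mulmxA skew_form0 // oppr0 addr0 dotE.
exists (drsubmx N), (ursubmx N); split.
  by rewrite trmx_drsub Nskew; apply/matrixP=> i j; rewrite !mxE.
move=> i; rewrite -[p' i](@row_mxKr _ 1 1 d (- dot (p i) (p' i))%:M).
rewrite -/(homv _ _) p'E -{1}[N]submxK mul_row_block row_mxKr mul1mx.
by rewrite addrC.
Qed.

End Homogeneous.

(** * Genericity and affine independence *)

(** The determinant is an integer polynomial in the coordinates.  It is not the
    zero polynomial, since it takes the value 1 at the origin and the standard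
    basis; genericity then forbids it to vanish at [p]. *)
Lemma generic_unitmx (R : realType) d (Gamma : sgraph) (p : framework R d Gamma)
    (g : 'I_(1 + d) -> Gamma) :
  generic p -> injective g -> \matrix_i hom (p (g i)) \in unitmx.
Proof.
move=> hgen g_inj; pose idx (v : Gamma) (k : 'I_d) := enum_rank (v, k).
pose M : 'M[mpoly #|{: Gamma * 'I_d}| int]_(1 + d) :=
  row_mx (const_mx 1) (\matrix_(i, k) mpolyX int (mnm1 (idx (g i) k))).
have evalM (S : comNzRingType) (f : {rmorphism int -> S}) h :
    mmap f h (\det M) =
    \det (row_mx (const_mx 1) (\matrix_(i, k) h (idx (g i) k)) : 'M_(1 + d)).
  rewrite -det_map_mx; congr (\det _); rewrite map_row_mx map_const_mx rmorph1.
  by congr row_mx; apply/matrixP=> i k; rewrite !mxE /= mmapX mmap1U.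
rewrite unitmxE unitfE; apply/negP=> /eqP det0.
have /hgen M0 : mmap intr (coords p) (\det M) = 0.
  rewrite evalM -[RHS]det0; congr (\det _); apply/row_matrixP=> i.
  rewrite rowK row_row_mx /hom; congr row_mx.
    by apply/rowP=> k; rewrite !mxE ord1.
  by apply/rowP=> k; rewrite !mxE /coords enum_rankK.
(* [h] places [g 0] at the origin and the other [g i] at the standard basis
   vectors. *)
pose h (k : 'I_#|{: Gamma * 'I_d}|) : int :=
  ((enum_val k).1 == g (rshift 1 (enum_val k).2))%:R.
have hE (i : 'I_(1 + d)) (k : 'I_d) : h (idx (g i) k) = (i == rshift 1 k)%:R.
  by rewrite /h enum_rankK (inj_eq g_inj).
have := evalM _ idfun h; rewrite M0 mmap0 det_trig => [/esym/eqP|].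
  rewrite big1 // => i _; rewrite -[i]splitK; case: (split i) => k /=.
    by rewrite row_mxEl mxE.
  by rewrite row_mxEr mxE hE eqxx.
apply/is_trig_mxP=> i j; rewrite -[j]splitK; case: (split j) => k /= lt_ij.
  by rewrite ord1 in lt_ij.
rewrite row_mxEr mxE hE; case: eqP => // eq_i.
by rewrite eq_i ltnn in lt_ij.
Qed.

(** * The rigidity matrix as a system of equations on quadrics *)

Section QuadricCoordinates.
Variables (R : realType) (d : nat).
Implicit Types (x y : 'rV[R]_d) (Q : 'M[R]_(1 + d)).

(** Blocks in the order of those of [constraint].  The mixed products of
    [constraint] are sums of two terms, so each off-diagonal coefficient of a
    symmetric [Q] is listed once and no factor 2 appears. *)
Definition quadric_coords Q : 'cV[R]_(qdim d) :=
  col_mx (\col_(i < d) Q (rshift 1 i) (rshift 1 i))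
 (col_mx (\col_(k < #|ltpairs d|)
            let jk := enum_val k in Q (rshift 1 jk.1) (rshift 1 jk.2))
 (col_mx (\col_(l < d) Q (lshift d 0) (rshift 1 l))
         (const_mx (Q (lshift d 0) (lshift d 0))))).

Lemma constraint_quadric x y Q : Q^T = Q ->
  constraint x y *m quadric_coords Q = hom x *m Q *m (hom y)^T.
Proof.
move=> Qsym; have QC i j : Q i j = Q j i by rewrite -{1}Qsym mxE.
rewrite !mul_row_col; apply/matrixP=> i j; rewrite !ord1 {i j}.
have hom0 (z : 'rV[R]_d) : hom z 0 (lshift d 0) = 1 by rewrite row_mxEl mxE.
have homS (z : 'rV[R]_d) k : hom z 0 (rshift 1 k) = z 0 k by rewrite row_mxEr.
move: (hom x) (hom y) (hom0 x) (hom0 y) (homS x) (homS y) => u w u0 w0 uS wS.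
rewrite -mulmxA !(mxE, big_split_ord, big_ord1) /= -[ord0]/(0 : 'I_1) u0 w0.
rewrite [X in _ = _ + X](eq_bigr (fun i => x 0 i * Q (lshift d 0) (rshift 1 i) +
   \sum_j x 0 i * Q (rshift 1 i) (rshift 1 j) * y 0 j)); last first.
  move=> i _; rewrite uS mxE big_split_ord big_ord1 /= mxE w0 mulr1 mulrDr QC.
  by congr (_ + _); rewrite mulr_sumr; apply: eq_bigr => j _; rewrite mxE wS mulrA.
rewrite big_split /= sum_sym_pairs [\sum_(e in ltpairs d) _]big_enum_val /= !mulr1 !mul1r.
under eq_bigr do rewrite !mxE.
under [X in _ + (X + _) = _]eq_bigr do rewrite !mxE.
under [X in _ + (_ + (X + _)) = _]eq_bigr do rewrite !mxE mulrDl [_ + y 0 _ * _]addrC.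
under [X in _ = (_ + X) + _]eq_bigr do rewrite mxE wS mulrC.
under [X in _ = _ + (_ + (X + _))]eq_bigr do rewrite mulrAC.
under [X in _ = _ + (_ + (_ + X))]eq_bigr => k _.
  rewrite [Q (rshift 1 (enum_val k).2) _]QC mulrAC [X in _ + X]mulrAC -mulrDl.
  over.
rewrite big_split /=; ring.
Qed.

Lemma quadric_coords0 : quadric_coords 0 = 0.
Proof.
have -> : 0 = col_mx 0 (col_mx 0 (col_mx 0 0)) :> 'cV[R]_(qdim d).
  by rewrite !col_mx0.
rewrite /quadric_coords.
by congr (col_mx _ (col_mx _ (col_mx _ _))); apply/colP=> i; rewrite !mxE.
Qed.

Lemma quadric_coords_surj (c : 'cV[R]_(qdim d)) :
  exists Q, Q^T = Q /\ quadric_coords Q = c.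
Proof.
pose c1 := usubmx c; pose c2 := usubmx (dsubmx c).
pose c3 := usubmx (dsubmx (dsubmx c)); pose c4 := dsubmx (dsubmx (dsubmx c)).
(* [off i j] is the entry of [c2] at the pair [(i, j)] when [i < j], and an
   empty sum otherwise. *)
pose off (i j : 'I_d) := \sum_(k | enum_val k == (i, j)) c2 k 0.
pose S := \matrix_(i, j) (if i == j then c1 i 0 else off i j + off j i).
exists (block_mx c4 c3^T c3 S); split.
  rewrite tr_block_mx trmxK; congr block_mx.
    by rewrite [c4]mx11_scalar tr_scalar_mx.
  apply/matrixP=> i j; rewrite !mxE eq_sym addrC.
  by case: eqP => // ->.
rewrite -[c]vsubmxK -[dsubmx c]vsubmxK -[dsubmx (dsubmx c)]vsubmxK.
congr (col_mx _ (col_mx _ (col_mx _ _))).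
- by apply/colP=> i; rewrite mxE block_mxEdr mxE eqxx.
- apply/colP=> k; rewrite mxE /= block_mxEdr mxE.
  have := enum_valP k; rewrite inE => lt_jk.
  rewrite ifN; last by apply: contraTneq lt_jk => ->; rewrite ltnn.
  rewrite /off (big_pred1 k) => [|l]; last first.
    by rewrite -surjective_pairing (inj_eq enum_val_inj).
  rewrite big_pred0 ?addr0 // => l; apply/eqP=> el.
  have := enum_valP l; rewrite inE el /= => /(ltn_trans lt_jk).
  by rewrite ltnn.
- by apply/colP=> l; rewrite mxE block_mxEur mxE.
- by apply/colP=> l; rewrite mxE block_mxEul !ord1.
Qed.

End QuadricCoordinates.

Section Joined.
Variables (R : realType) (d : nat) (G H : sgraph) (p : framework R d (join G H)).

Definition on_quadric (Q : 'M[R]_(1 + d)) : Prop :=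
  (forall i, hom (p i) *m Q *m (hom (p i))^T = 0) /\
  (forall i j, extraneous i j -> hom (p i) *m Q *m (hom (p j))^T = 0).

(** Each unordered extraneous edge gives a single row; the symmetry of [Q]
    recovers the equation for the other orientation. *)
Lemma quadric_rigidity_mx_ker (Q : 'M[R]_(1 + d)) : Q^T = Q ->
  quadric_rigidity_mx p *m quadric_coords Q = 0 <-> on_quadric Q.
Proof.
move=> Qsym; rewrite mul_col_mx.
rewrite (matrix_row_mul (fun k => constraint (p (enum_val k)) (p (enum_val k)))).
rewrite (matrix_row_mul (fun k => constraint (p (enum_val k).1) (p (enum_val k).2))).
split=> [/eqP|[Qp Qe]].
  rewrite -col_mx0; move/eqP/eq_col_mx=> [Qp Qe]; split=> [i|i j eij].
    have /row_matrixP/(_ (enum_rank i)) := Qp.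
    by rewrite rowK row0 enum_rankK constraint_quadric.
  wlog lt_ij : i j eij / (enum_rank i < enum_rank j)%N => [wlog_lt|].
    have [|lt_ji|/ord_inj/enum_rank_inj eq_ij] := ltngtP (enum_rank i) (enum_rank j).
    - exact: wlog_lt.
    - apply: trmx_inj; rewrite trmx0 !trmx_mul trmxK Qsym mulmxA wlog_lt //.
      by case: i j eij {lt_ji} => [a|a] [b|b] //=; rewrite adj_sym.
    - by case: i j eij eq_ij => [a|a] [b|b] //= eab [] eq_ab; rewrite eq_ab adj_irr in eab.
  have eE : (i, j) \in extraneous_edges G H by rewrite inE eij.
  have /row_matrixP/(_ (enum_rank_in eE (i, j))) := Qe.
  by rewrite rowK row0 enum_rankK_in //= constraint_quadric.
rewrite -col_mx0; congr col_mx; apply/row_matrixP=> k; rewrite rowK row0.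
  by rewrite constraint_quadric.
rewrite constraint_quadric // Qe //.
by have := enum_valP k; rewrite inE => /andP[].
Qed.

(** * Flexes and quadrics *)

Hypothesis hgen : generic p.
Hypothesis hbal : balanced G H d.

Lemma balanced_bases :
  (exists f : 'I_(1 + d) -> G, \matrix_i hom (p (inl (f i) : join G H)) \in unitmx) /\
  (exists f : 'I_(1 + d) -> H, \matrix_i hom (p (inr (f i) : join G H)) \in unitmx).
Proof.
case: hbal => dG dH; split.
  exists (fun i => enum_val (widen_ord dG i)).
  by apply: (generic_unitmx hgen) => i j [] /enum_val_inj/(congr1 val) /= /val_inj.
exists (fun i => enum_val (widen_ord dH i)).
by apply: (generic_unitmx hgen) => i j [] /enum_val_inj/(congr1 val) /= /val_inj.
Qed.

Lemma joined_motion_matrix (p' : join G H -> 'rV[R]_d) :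
  infinitesimal_motion p p' ->
  exists N : 'M[R]_(1 + d), forall i, homv (p i) (p' i) =
    hom (p i) *m (if i is inl _ then N else - N^T).
Proof.
move=> p'_motion; have [[f unitG] [g unitH]] := balanced_bases.
have [a b|N [NG NH]] := @linear_from_crossing _ _ G H
  (fun a => hom (p (inl a : join G H)))
  (fun a => homv (p (inl a : join G H)) (p' (inl a)))
  (fun b => hom (p (inr b : join G H)))
  (fun b => homv (p (inr b : join G H)) (p' (inr b))) f g unitG unitH.
  by rewrite edge_homv p'_motion // oppr0 raddf0.
by exists N; case=> [a|b]; [exact: NG | rewrite mulmxN; exact: NH].
Qed.

(** The quadric is twice the symmetric part of the matrix of the motion, which
    vanishes only for Euclidean motions. *)
Lemma joined_flex_quadric (p' : join G H -> 'rV[R]_d) :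
  infinitesimal_flex p p' -> exists Q, [/\ Q^T = Q, Q != 0 & on_quadric Q].
Proof.
move=> [p'_motion p'_nE]; have [N p'N] := joined_motion_matrix p'_motion.
have NQ i : hom (p i) *m N *m (hom (p i))^T = 0.
  have := mul_homv_hom (p i) (p' i) (p i); rewrite subrr raddf0 p'N.
  case: i => // b.
  rewrite mulmxN mulNmx => /eqP; rewrite oppr_eq0 => /eqP/(congr1 trmx).
  by rewrite !trmx_mul !trmxK trmx0 mulmxA.
have NQt i : hom (p i) *m N^T *m (hom (p i))^T = 0.
  by apply: trmx_inj; rewrite !trmx_mul !trmxK trmx0 mulmxA.
exists (N + N^T); split.
- by rewrite linearD /= trmxK addrC.
- apply/eqP=> /eqP; rewrite addr_eq0 => /eqP NNt; apply: p'_nE.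
  apply/infinitesimal_Euclidean_skew; exists N; split.
    by rewrite [in RHS]NNt opprK.
  by case=> [a|b]; rewrite p'N // -NNt.
- split=> [i|i j eij]; first by rewrite mulmxDr mulmxDl NQ NQt addr0.
  have := edge_homv (p i) (p j) (p' i) (p' j).
  rewrite p'_motion; last by rewrite /= /join_adj eij.
  rewrite oppr0 raddf0 !p'N trmx_mul mulmxA.
  case: i j eij => [a|b] [a'|b'] //= _.
    by rewrite mulmxDr mulmxDl.
  rewrite !mulmxN raddfN /= trmxK mulmxN !mulNmx -opprD => /eqP.
  by rewrite oppr_eq0 mulmxDr mulmxDl addrC => /eqP.
Qed.

(** The opposite signs on the two sides make the two terms of a crossing edge
    cancel; on an extraneous edge the two terms are equal, and both vanish. *)
Lemma quadric_joined_flex (Q : 'M[R]_(1 + d)) :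
  Q^T = Q -> Q != 0 -> on_quadric Q -> exists p', infinitesimal_flex p p'.
Proof.
move=> Qsym Q_neq0 [Qp Qe].
pose Qs (i : join G H) := if i is inl _ then Q else - Q.
have Qs_sym i : (Qs i)^T = Qs i by case: i => ? /=; rewrite ?raddfN /= Qsym.
pose p' i := rsubmx (hom (p i) *m Qs i).
have p'E i : homv (p i) (p' i) = hom (p i) *m Qs i.
  apply: homv_rsubmx; rewrite trmx_mul Qs_sym mulmxA.
  by case: i => [a|b] /=; rewrite ?mulmxN ?mulNmx Qp ?oppr0.
exists p'; split=> [i j|].
  move=> adj_ij; have := edge_homv (p i) (p j) (p' i) (p' j).
  rewrite !p'E trmx_mul Qs_sym mulmxA.
  suff -> : hom (p i) *m Qs i *m (hom (p j))^T +
            hom (p i) *m Qs j *m (hom (p j))^T = 0.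
    by move/matrixP/(_ 0 0); rewrite !mxE mulr1n => /esym/eqP; rewrite oppr_eq0 => /eqP.
  move: adj_ij; rewrite /= /join_adj => /orP[eij|].
    have := Qe _ _ eij; case: i j eij => [a|b] [a'|b'] //= _ Qij.
      by rewrite Qij addr0.
    by rewrite !mulmxN !mulNmx Qij subr0 oppr0.
  case: i j => [a|b] [a'|b'] //= _.
    by rewrite mulmxN mulNmx subrr.
  by rewrite mulmxN mulNmx addNr.
move=> /infinitesimal_Euclidean_skew[N [Nskew p'N]].
have [[f unitG] _] := balanced_bases.
have QN : Q = N.
  apply: (can_inj (mulKmx unitG)).
  rewrite !matrix_row_mul; apply/row_matrixP=> i; rewrite !rowK.
  by rewrite -p'N p'E.
move/eqP: Q_neq0; apply; apply: eq_oppmx0.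
by rewrite {2}QN -Nskew -QN Qsym.
Qed.

Lemma quadric_coords_eq0 (Q : 'M[R]_(1 + d)) :
  Q^T = Q -> quadric_coords Q = 0 -> Q = 0.
Proof.
move=> Qsym Q0; have [[f unitG] _] := balanced_bases.
apply: (quadric_eq0 unitG) => i j.
by rewrite -constraint_quadric // Q0 mulmx0.
Qed.

End Joined.

Theorem proposition5p3 (R : realType) (d : nat) (hd : (1 <= d)%N)
    (G H : sgraph) (hbal : balanced G H d) (p : framework R d (join G H))
    (hgen : generic p) :
  \rank (quadric_rigidity_mx p) = 'C(d + 2, 2) <-> infinitesimally_rigid p.
Proof.
rewrite -qdimE; split=> [/eqP/row_fullP_ker ker0 [p' p'_flex]|rigid].
  have [Q [Qsym Q_neq0 Qp]] := joined_flex_quadric hgen hbal p'_flex.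
  move/eqP: Q_neq0; apply; apply: (quadric_coords_eq0 hgen hbal Qsym).
  by apply: ker0; apply/quadric_rigidity_mx_ker.
apply/eqP/row_fullP_ker => c; have [Q [Qsym <-]] := quadric_coords_surj c.
move=> /quadric_rigidity_mx_ker -/(_ Qsym) Qp.
have [->|Q_neq0] := eqVneq Q 0; first exact: quadric_coords0.
by case: rigid; apply: (quadric_joined_flex hgen hbal Qsym).
Qed.
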